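(* Let $0<a<b$ and $s\in(0,1)$, and let $M>0$ be such that $s(1-s)t^{s-2}\le M$ for all $t\in[a,b]$. Write $A=A(a,b)$. Then for all $x\in[a,b]$ $$\left|L_s^s(a,b)-x^s+s(x-A)x^{s-1}\right|\le 3M\left(\frac{s^2+3s+4}{(s+1)(s+2)(s+3)}\right)\left[\frac{1}{24}(b-a)^2+\frac12(x-A)^2\right]\le M\frac{(b-a)^2}{2}\left(\frac{s^2+3s+4}{(s+1)(s+2)(s+3)}\right).$$ In particular, taking $x=A$, $$\left|L_s^s(a,b)-A^s\right|\le\frac{M(b-a)^2}{8}\left(\frac{s^2+3s+4}{(s+1)(s+2)(s+3)}\right).$$
   Context: For $a,b>0$ with $a\neq b$: the arithmetic mean is $A(a,b)=\frac{a+b}{2}$; the generalized log-mean is $L_p(a,b)=\left[\frac{b^{p+1}-a^{p+1}}{(p+1)(b-a)}\right]^{1/p}$ for $p\in\mathbb{R}\setminus\{-1,0\}$; and $L_s^s(a,b)=(L_s(a,b))^s$. *)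

(* Defs.v *)
From Stdlib Require Import Reals.
Open Scope R_scope.

Definition arith_mean (a b : R) : R := (a + b) / 2.

(* Meaningful for a, b > 0, a <> b and p different from -1 and 0; the base of
   the outer power is then positive, as [Rpower] requires. *)
Definition gen_log_mean (p a b : R) : R :=
  Rpower ((Rpower b (p + 1) - Rpower a (p + 1)) / ((p + 1) * (b - a))) (1 / p).

(* Main.v *)
(** The quantity [L_s^s] is the mean of [t^s] over [[a, b]].  Averaging over [t] the
    first-order Taylor bound at [x], with remainder at most [M (t - x)^2 / 2],
    bounds the left-hand side by [M ((b - a)^2 / 24 + (x - A)^2 / 2)], and the
    rational factor in the statement only weakens this, being at least [1/3] for
    [0 < s < 1].  The averaging is done on an antiderivative, so that only the mean
    value theorem is needed. *)

Require Import Defs.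
From Stdlib Require Import Reals Lra.
From Coquelicot Require Import Coquelicot.
Open Scope R_scope.

Lemma is_derive_nonneg_le (f g : R -> R) (a b : R) :
  a <= b ->
  (forall t, a <= t <= b -> is_derive f t (g t)) ->
  (forall t, a <= t <= b -> 0 <= g t) ->
  f a <= f b.
Proof.
intros [hab | ->] hd hg; [| lra].
destruct (MVT_cor2 f g a b hab) as [c [hc hcab]].
- intros t ht; apply is_derive_Reals, hd, ht.
- assert (0 <= g c) by (apply hg; lra).
  nra.
Qed.

(** A convex function lies above its tangent at [x]: on either side of [x] the mean value theorem
    turns the increment into a slope [g c], which is then compared with [g x] by monotonicity of
    [g]. *)
Lemma tangent_le (f g h : R -> R) (a b x t : R) :
  (forall u, a <= u <= b -> is_derive f u (g u)) ->
  (forall u, a <= u <= b -> is_derive g u (h u)) ->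
  (forall u, a <= u <= b -> 0 <= h u) ->
  a <= x <= b -> a <= t <= b ->
  f x + g x * (t - x) <= f t.
Proof.
intros hf hg hh hx ht.
assert (mono : forall u v, a <= u -> u <= v -> v <= b -> g u <= g v).
{ intros u v hau huv hvb.
  apply (is_derive_nonneg_le g h); [lra | |]; intros w hw;
    [apply hg | apply hh]; lra. }
destruct (Rtotal_order x t) as [hxt | [-> | hxt]]; [| lra |].
- destruct (MVT_cor2 f g x t hxt) as [c [hc hcxt]].
  + intros u hu; apply is_derive_Reals, hf; lra.
  + assert (g x <= g c) by (apply mono; lra). nra.
- destruct (MVT_cor2 f g t x hxt) as [c [hc hcxt]].
  + intros u hu; apply is_derive_Reals, hf; lra.
  + assert (g c <= g x) by (apply mono; lra). nra.
Qed.

Lemma tangent_midpoint_le (F f g h : R -> R) (a b x : R) :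
  a <= x <= b ->
  (forall t, a <= t <= b -> is_derive F t (f t)) ->
  (forall t, a <= t <= b -> is_derive f t (g t)) ->
  (forall t, a <= t <= b -> is_derive g t (h t)) ->
  (forall t, a <= t <= b -> 0 <= h t) ->
  (b - a) * (f x + g x * ((a + b) / 2 - x)) <= F b - F a.
Proof.
intros hx hF hf hg hh.
(* The subtracted term is an antiderivative of the tangent line at [x], so [P] has as derivative the
   gap between [f] and that tangent. *)
pose (P t := F t - (f x * t + g x * ((t - x) ^ 2 / 2))).
assert (hP : P a <= P b).
{ apply (is_derive_nonneg_le P (fun t => f t - (f x + g x * (t - x)))); [lra | |].
  - intros t ht.
    apply @is_derive_minus; [now apply hF |].
    auto_derive; [easy | field].
  - intros t ht.
    pose proof (tangent_le f g h a b x t hf hg hh hx ht); lra. }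
unfold P in hP; nra.
Qed.

(** Adding [M * (t - x) ^ 2 / 2] to [f] makes it convex without changing its value or slope at [x],
    which reduces the claim to [tangent_midpoint_le]. *)
Lemma tangent_midpoint_lower (F f g h : R -> R) (a b x M : R) :
  a <= x <= b ->
  (forall t, a <= t <= b -> is_derive F t (f t)) ->
  (forall t, a <= t <= b -> is_derive f t (g t)) ->
  (forall t, a <= t <= b -> is_derive g t (h t)) ->
  (forall t, a <= t <= b -> - M <= h t) ->
  - (M * (b - a) * ((b - a) ^ 2 / 24 + (x - (a + b) / 2) ^ 2 / 2))
  <= F b - F a - (b - a) * (f x + g x * ((a + b) / 2 - x)).
Proof.
intros hx hF hf hg hh.
assert (H : (b - a) * (f x + M * (x - x) ^ 2 / 2
                  + (g x + M * (x - x)) * ((a + b) / 2 - x))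
  <= F b + M * (b - x) ^ 3 / 6 - (F a + M * (a - x) ^ 3 / 6)).
{ apply (tangent_midpoint_le (fun t => F t + M * (t - x) ^ 3 / 6)
    (fun t => f t + M * (t - x) ^ 2 / 2) (fun t => g t + M * (t - x))
    (fun t => h t + M) a b x hx); intros t ht.
  - apply @is_derive_plus; [now apply hF | auto_derive; [easy | field]].
  - apply @is_derive_plus; [now apply hf | auto_derive; [easy | field]].
  - apply @is_derive_plus; [now apply hg | auto_derive; [easy | ring]].
  - specialize (hh t ht); lra. }
(* With [A = (a + b) / 2], the cubic terms contribute [((b - x) ^ 3 - (a - x) ^ 3) / 6 = (b - a) *
   ((b - a) ^ 2 / 24 + (x - A) ^ 2 / 2)]. *)
nra.
Qed.

Lemma tangent_midpoint_abs (F f g h : R -> R) (a b x M : R) :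
  a <= x <= b ->
  (forall t, a <= t <= b -> is_derive F t (f t)) ->
  (forall t, a <= t <= b -> is_derive f t (g t)) ->
  (forall t, a <= t <= b -> is_derive g t (h t)) ->
  (forall t, a <= t <= b -> Rabs (h t) <= M) ->
  Rabs (F b - F a - (b - a) * (f x + g x * ((a + b) / 2 - x)))
  <= M * (b - a) * ((b - a) ^ 2 / 24 + (x - (a + b) / 2) ^ 2 / 2).
Proof.
intros hx hF hf hg hh.
assert (hl := tangent_midpoint_lower F f g h a b x M hx hF hf hg).
(* The upper bound is the lower bound for the negated functions. *)
assert (hu := tangent_midpoint_lower (fun t => - F t) (fun t => - f t)
  (fun t => - g t) (fun t => - h t) a b x M hx).
apply Rabs_le; split.
- apply hl; intros t ht; specialize (hh t ht); apply Rabs_le_between in hh; lra.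
- apply Ropp_le_cancel.
  eapply Rle_trans; [apply hu; intros t ht | right; ring].
  + now apply (is_derive_opp F), hF.
  + now apply (is_derive_opp f), hf.
  + now apply (is_derive_opp g), hg.
  + specialize (hh t ht); apply Rabs_le_between in hh; lra.
Qed.

Lemma is_derive_Rpower (p t : R) :
  0 < t -> is_derive (fun u => Rpower u p) t (p * Rpower t (p - 1)).
Proof.
intros ht; apply is_derive_Reals, derivable_pt_lim_power, ht.
Qed.

Lemma Rpower_gen_log_mean (p a b : R) :
  0 < a -> a < b -> 0 < p ->
  Rpower (gen_log_mean p a b) p
  = (Rpower b (p + 1) - Rpower a (p + 1)) / ((p + 1) * (b - a)).
Proof.
intros ha hab hp; unfold gen_log_mean.
rewrite Rpower_mult.
replace (1 / p * p) with 1 by (field; lra).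
(* [Rpower y 1] equals [y] only for positive [y], hence the positivity of the quotient. *)
apply Rpower_1, Rdiv_lt_0_compat; [| nra].
assert (Rpower a (p + 1) < Rpower b (p + 1)) by (apply Rlt_Rpower_l; lra).
lra.
Qed.

Lemma gen_log_mean_taylor (a b s M x : R) :
  0 < a -> a < b -> 0 < s -> s < 1 ->
  (forall t, a <= t <= b -> s * (1 - s) * Rpower t (s - 2) <= M) ->
  a <= x <= b ->
  Rabs (Rpower (gen_log_mean s a b) s - Rpower x s
        + s * (x - arith_mean a b) * Rpower x (s - 1))
  <= M * (1 / 24 * (b - a) ^ 2 + 1 / 2 * (x - arith_mean a b) ^ 2).
Proof.
intros ha hab hs0 hs1 hbound hx.
assert (H := tangent_midpoint_abs (fun t => Rpower t (s + 1) / (s + 1))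
  (fun t => Rpower t s) (fun t => s * Rpower t (s - 1))
  (fun t => s * ((s - 1) * Rpower t (s - 2))) a b x M hx).
rewrite Rpower_gen_log_mean by lra.
unfold arith_mean.
(* Scaling by [b - a] turns the mean of [t^s] into the increment of its antiderivative, the form of
   [H]. *)
apply (Rmult_le_reg_l (b - a)); [lra |].
rewrite <- (Rabs_pos_eq (b - a)) at 1 by lra.
rewrite <- Rabs_mult.
match goal with |- Rabs ?u <= ?v =>
  match type of H with _ -> _ -> _ -> _ -> Rabs ?u' <= ?v' =>
    replace u with u' by (field; lra); replace v with v' by field
  end
end.
apply H; intros t ht.
- replace (Rpower t s) with (/ (s + 1) * ((s + 1) * Rpower t (s + 1 - 1))).
  + apply (is_derive_ext (fun u => / (s + 1) * Rpower u (s + 1))).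
    * intros u; apply Rmult_comm.
    * apply is_derive_scal, is_derive_Rpower; lra.
  + replace (s + 1 - 1) with s by ring; field; lra.
- apply is_derive_Rpower; lra.
- replace (s - 2) with (s - 1 - 1) by ring.
  apply is_derive_scal, is_derive_Rpower; lra.
- assert (0 < Rpower t (s - 2)) by apply exp_pos.
  specialize (hbound t ht).
  replace (s * ((s - 1) * Rpower t (s - 2)))
    with (- (s * (1 - s) * Rpower t (s - 2))) by ring.
  rewrite Rabs_Ropp, Rabs_pos_eq; [exact hbound |].
  apply Rmult_le_pos; nra.
Qed.

Lemma one_third_le_ratio (s : R) :
  0 < s -> s < 1 ->
  1 / 3 <= (s ^ 2 + 3 * s + 4) / ((s + 1) * (s + 2) * (s + 3)).
Proof.
intros hs0 hs1.
apply -> Rle_div_r.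
(* This product is [3 * (s ^ 2 + 3 * s + 4) - (s + 1) * (s + 2) * (s + 3)]. *)
- assert (0 <= (1 - s) * (s ^ 2 + 4 * s + 6)) by nra.
  nra.
- apply Rmult_lt_0_compat; nra.
Qed.

Theorem proposition1 (a b s M : R) (ha : 0 < a) (hab : a < b)
  (hs0 : 0 < s) (hs1 : s < 1) (hM : 0 < M)
  (hbound : forall t : R, a <= t <= b -> s * (1 - s) * Rpower t (s - 2) <= M) :
  (forall x : R, a <= x <= b ->
     Rabs (Rpower (gen_log_mean s a b) s - Rpower x s
           + s * (x - arith_mean a b) * Rpower x (s - 1))
     <= 3 * M * ((s ^ 2 + 3 * s + 4) / ((s + 1) * (s + 2) * (s + 3)))
        * (1 / 24 * (b - a) ^ 2 + 1 / 2 * (x - arith_mean a b) ^ 2)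
     <= M * ((b - a) ^ 2 / 2)
        * ((s ^ 2 + 3 * s + 4) / ((s + 1) * (s + 2) * (s + 3))))
  /\
  Rabs (Rpower (gen_log_mean s a b) s - Rpower (arith_mean a b) s)
  <= M * (b - a) ^ 2 / 8
     * ((s ^ 2 + 3 * s + 4) / ((s + 1) * (s + 2) * (s + 3))).
Proof.
assert (hC := one_third_le_ratio s hs0 hs1).
set (C := (s ^ 2 + 3 * s + 4) / ((s + 1) * (s + 2) * (s + 3))) in *.
assert (bounds : forall x, a <= x <= b ->
     Rabs (Rpower (gen_log_mean s a b) s - Rpower x s
           + s * (x - arith_mean a b) * Rpower x (s - 1))
     <= 3 * M * C * (1 / 24 * (b - a) ^ 2 + 1 / 2 * (x - arith_mean a b) ^ 2)
     <= M * ((b - a) ^ 2 / 2) * C).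
{ intros x hx; split.
  - eapply Rle_trans;
      [exact (gen_log_mean_taylor a b s M x ha hab hs0 hs1 hbound hx) |].
    apply Rmult_le_compat_r; [| nra].
    pose proof (pow2_ge_0 (b - a)); pose proof (pow2_ge_0 (x - arith_mean a b)).
    lra.
  - assert (0 <= M * C) by nra.
    (* A point of [[a, b]] is within [(b - a) / 2] of the midpoint, so the bracket is at most [(1/24
       + 1/8) * (b - a) ^ 2 = (b - a) ^ 2 / 6]. *)
    assert ((x - arith_mean a b) ^ 2 <= (b - a) ^ 2 / 4)
      by (unfold arith_mean; nra).
    nra. }
split; [exact bounds |].
destruct (bounds (arith_mean a b)) as [H _]; [unfold arith_mean; lra |].
(* At the midpoint the first-order term vanishes and the constant becomes [3 / 24 = 1 / 8]. *)
replace (arith_mean a b - arith_mean a b) with 0 in H by ring.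
rewrite Rmult_0_r, Rmult_0_l, Rplus_0_r in H.
eapply Rle_trans; [exact H | right; field].
Qed.
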